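(* Let $m,n,q$ be positive integers and let $S$ be a subset of $\mathsf{Frame}(m\times n)$ that is fixed under $180^\circ$ rotation of the rectangle $m\times n$. Then $(\mathrm{Inc}^q(m\times n), \mathcal{P}, \mathrm{wt}_S)$ exhibits homomesy with orbit average $\frac{(q+1)|S|}{2}$; that is, for every orbit $\mathcal{O}$ of $K$-promotion $\mathcal{P}$ acting on $\mathrm{Inc}^q(m\times n)$, one has $\frac{1}{|\mathcal{O}|}\sum_{U\in\mathcal{O}} \mathrm{wt}_S(U) = \frac{(q+1)|S|}{2}$.
   Context: Partitions are identified with their Ferrers diagrams in English orientation; $m\times n$ denotes the rectangle with $m$ rows and $n$ columns. An increasing tableau of shape $\lambda$ is a filling of the boxes of $\lambda$ by positive integers strictly increasing left to right along rows and top to bottom down columns; $\mathrm{Inc}^q(\lambda)$ is the set of such tableaux with all entries at most $q$. $K$-promotion: consider fillings of $\lambda$ by positive integers and the symbol $\bullet$. For a positive integer $i$, the operator $\mathsf{swap}_i$ acts as follows: consider the set of boxes containing $i$ or $\bullet$ and decompose it into edge-connected components; on a component consisting of a single box do nothing; on each component with at least two boxes simultaneously replace every $i$ by $\bullet$ and every $\bullet$ by $i$. Let $\mathsf{Rep}_{1\to\bullet}$ replace every entry $1$ by $\bullet$, $\mathsf{Rep}_{\bullet\to q+1}$ replace every $\bullet$ by $q+1$, and $\mathsf{Decr}$ decrease every numerical entry by $1$. For $T\in\mathrm{Inc}^q(\lambda)$, $\mathcal{P}(T) := \mathsf{Decr}\circ \mathsf{Rep}_{\bullet\to q+1}\circ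 \mathsf{swap}_q\circ\cdots\circ\mathsf{swap}_2\circ \mathsf{Rep}_{1\to\bullet}(T)$, a bijection of $\mathrm{Inc}^q(\lambda)$. The frame $\mathsf{Frame}(\lambda)$ is the set of boxes lying in the first row, the last row, the first column, or the last column of $\lambda$. For a set $S$ of boxes and a tableau $T$, $\mathrm{wt}_S(T)$ is the sum of the entries of $T$ in the boxes of $S$. A set with a weight function and a group action is homomesic if every orbit has the same average weight. *)

(* Defs.v *)
From HB Require Import structures.
From mathcomp Require Import all_boot all_order all_algebra all_fingroup.
From mathcomp Require Import zify.

Set Implicit Arguments.
Unset Strict Implicit.
Unset Printing Implicit Defensive.

(* The box (i, j) of the rectangle is in row i (counted from the top) and
   column j (counted from the left), both 0-based. *)
Definition box (m n : nat) := ('I_m * 'I_n)%type.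

Section Boxes.
Variables m n : nat.
Implicit Types b c : box m n.

Definition row_before b c := (b.1 == c.1) && (b.2 < c.2).
Definition col_before b c := (b.2 == c.2) && (b.1 < c.1).
Definition before b c := row_before b c || col_before b c.

Definition edge_adjacent b c :=
  (b.1 == c.1) && ((b.2.+1 == c.2 :> nat) || (c.2.+1 == b.2 :> nat)) ||
  (b.2 == c.2) && ((b.1.+1 == c.1 :> nat) || (c.1.+1 == b.1 :> nat)).

Definition frame : {set box m n} :=
  [set b : box m n | [|| b.1 == 0 :> nat, b.1 == m.-1 :> nat,
                          b.2 == 0 :> nat | b.2 == n.-1 :> nat]].

Definition rot180 b : box m n := (rev_ord b.1, rev_ord b.2).

End Boxes.

Definition increasing m n q (T : {ffun box m n -> 'I_q.+1}) :=
  [forall b, 0 < T b] && [forall b, forall c, before b c ==> (T b < T c)].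

(* Inc^q(m x n) *)
Record inc_tableau (m n q : nat) := IncTableau {
  entries :> {ffun box m n -> 'I_q.+1};
  entries_inc : increasing entries }.

HB.instance Definition _ m n q := [isSub for @entries m n q].
HB.instance Definition _ m n q := [Finite of inc_tableau m n q by <:].

(* None is the symbol bullet *)
Definition filling (m n : nat) := {ffun box m n -> option nat}.

Section KPromotionSteps.
Variables m n : nat.
Implicit Types (F : filling m n) (b c : box m n) (i : nat).

Definition swappable i F b := (F b == None) || (F b == Some i).

Definition swap_edge i F : rel (box m n) := fun b c =>
  [&& swappable i F b, swappable i F c & edge_adjacent b c].

(* For b swappable, its edge-connected component among swappable boxes. *)
Definition component i F b : {set box m n} :=
  [set c | connect (swap_edge i F) b c].

Definition swap i F : filling m n :=
  [ffun b => if swappable i F b && (1 < #|component i F b|)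
             then (if F b == None then Some i else None) else F b].

Definition rep_1_bullet F : filling m n :=
  [ffun b => if F b == Some 1 then None else F b].

Definition rep_bullet k F : filling m n :=
  [ffun b => if F b == None then Some k else F b].

Definition decr F : filling m n := [ffun b => omap predn (F b)].

(* swap_q o ... o swap_2 *)
Definition swaps q F : filling m n :=
  foldl (fun G i => swap i G) F (iota 2 q.-1).

End KPromotionSteps.

Definition to_filling m n q (T : {ffun box m n -> 'I_q.+1}) : filling m n :=
  [ffun b => Some (T b : nat)].

Definition promotion_filling m n q (T : inc_tableau m n q) : filling m n :=
  decr (rep_bullet q.+1 (swaps q (rep_1_bullet (to_filling T)))).

(* Reading the result back as a tableau; by promotion_entriesE below the
   default value and the truncation in inord are never used. *)
Definition promotion_entries m n q (T : inc_tableau m n q) :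
    {ffun box m n -> 'I_q.+1} :=
  [ffun b => inord (odflt 0 (promotion_filling T b))].

Section PromotionFacts.
Variables m n : nat.
Implicit Types (F : filling m n) (b c : box m n) (i : nat).

Lemma edge_adjacent_sym b c : edge_adjacent b c = edge_adjacent c b.
Proof.
by rewrite /edge_adjacent ![c.1 == b.1]eq_sym ![c.2 == b.2]eq_sym
           ![(c.2.+1 == _) || _]orbC ![(c.1.+1 == _) || _]orbC.
Qed.

Lemma swap_edge_big i F b c : b != c -> swap_edge i F b c ->
  1 < #|component i F b|.
Proof.
move=> nbc e; rewrite (cardsD1 b) (cardsD1 c) !inE connect0 eq_sym nbc /=.
by rewrite connect1.
Qed.

Lemma swappable_swap i F : swappable i (swap i F) =1 swappable i F.
Proof.
move=> b; rewrite /swappable ffunE /swappable.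
case: (F b) => [v|] /=; case: ifP => //=; last by rewrite eqxx.
by case/andP=> ->.
Qed.

Lemma component_swap i F : component i (swap i F) =1 component i F.
Proof.
move=> b; apply/setP=> c; rewrite !inE; apply: eq_connect => x y.
by rewrite /swap_edge !swappable_swap.
Qed.

Lemma swapK i : involutive (@swap m n i).
Proof.
move=> F; apply/ffunP=> b.
rewrite ffunE swappable_swap component_swap ffunE.
case: (boolP (_ && _)) => // /andP[sb _]; move: sb; rewrite /swappable.
by case: (F b) => [v|] //= /eqP ->.
Qed.

Lemma swaps_inj q : injective (@swaps m n q).
Proof.
rewrite /swaps; elim: (iota _ _) => //= i s IH F G /IH.
exact: inv_inj (swapK i) _ _.
Qed.

(* Between swap_i and swap_(i+1) a bullet counts as an entry i + 1/2;
   key doubles all values. *)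
Let key i (x : option nat) := if x is Some v then v.*2 else i.*2.+1.

Definition swap_inv q i F :=
  (forall b c, before b c -> key i (F b) < key i (F c)) /\
  (forall b v, F b = Some v -> 1 < v <= q).

Lemma swap_inv_step q i F : 0 < i < q -> swap_inv q i F ->
  swap_inv q i.+1 (swap i.+1 F).
Proof.
move=> /andP[i0 iq] [Finc Fbnd]; split; last first.
  move=> b v; rewrite ffunE; case: ifP => _; last exact: Fbnd.
  by case: ifP => // _ [<-]; rewrite ltnS i0.
have adj b c : before b c -> F b = None -> F c = Some i.+1 ->
    (1 < #|component i.+1 F b|) && (1 < #|component i.+1 F c|).
  move=> bc Fb Fc.
  have eadj : edge_adjacent b c.
    have := bc; rewrite /before /row_before /col_before /edge_adjacent.
    case: b c bc Fb Fc => [b1 b2] [c1 c2] /= bc Fb Fc.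
    case/orP=> /andP[/eqP E lt]; apply/orP; [left|right];
      rewrite E eqxx /=; subst.
    - case: (eqVneq b2.+1 (c2 : nat)) => // ne; have {}lt : b2.+1 < c2 by lia.
      have d2 : b2.+1 < n by apply: ltn_trans lt (ltn_ord _).
      have /Finc : before (c1, b2) (c1, Ordinal d2).
        by rewrite /before /row_before /= eqxx ltnSn.
      have /Finc : before (c1, Ordinal d2) (c1, c2).
        by rewrite /before /row_before /= eqxx lt.
      by rewrite Fb Fc; case: (F (c1, Ordinal d2)) => [v|] /=; lia.
    - case: (eqVneq b1.+1 (c1 : nat)) => // ne; have {}lt : b1.+1 < c1 by lia.
      have d1 : b1.+1 < m by apply: ltn_trans lt (ltn_ord _).
      have /Finc : before (b1, c2) (Ordinal d1, c2).
        by rewrite /before /col_before /= eqxx ltnSn orbT.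
      have /Finc : before (Ordinal d1, c2) (c1, c2).
        by rewrite /before /col_before /= eqxx lt orbT.
      by rewrite Fb Fc; case: (F (Ordinal d1, c2)) => [v|] /=; lia.
  have nbc : b != c by apply/eqP => E; move: Fc; rewrite -E Fb.
  have sb : swappable i.+1 F b by rewrite /swappable Fb.
  have sc : swappable i.+1 F c by rewrite /swappable Fc eqxx.
  apply/andP; split.
    by apply: (swap_edge_big nbc); rewrite /swap_edge sb sc.
  apply: (@swap_edge_big _ _ _ b); first by rewrite eq_sym.
  by rewrite /swap_edge sb sc edge_adjacent_sym.
move=> b c bc; have := Finc _ _ bc; have := adj _ _ bc.
rewrite !ffunE /swappable.
case Fb: (F b) => [v|]; case Fc: (F c) => [w|] //=; last by lia.
- move=> _ lt; case: ifP => [/andP[/eqP[Ev] _]|_];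
    case: ifP => [/andP[/eqP[Ew] _]|_] /=; lia.
- move=> _ lt; case: ifP => [/andP[/eqP[Ev] _]|_]; case: ifP => _ /=; lia.
- move=> /(_ erefl) A lt.
  case: (eqVneq w i.+1) A lt => [-> /(_ erefl)/andP[-> ->]|nw _ lt] /=.
    by rewrite eqxx /=; lia.
  have -> : (Some w == Some i.+1) = false.
    by apply/eqP => -[E]; rewrite E eqxx in nw.
  by case: ifP => _ /=; lia.
Qed.

Lemma swap_inv0 q (T : inc_tableau m n q) :
  swap_inv q 1 (rep_1_bullet (to_filling T)).
Proof.
case/andP: (entries_inc T) => /forallP T0 /forallP Tinc; split.
  move=> b c bc; have := implyP (forallP (Tinc b) c) bc.
  have := T0 b; have := T0 c; rewrite !ffunE.
  by do 2!case: eqP => [[?]|?] /=; lia.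
move=> b v; rewrite !ffunE; case: eqP => // N [<-].
have /= := ltn_ord (T b); have := T0 b.
by case: (T b : nat) N => [|[|]] //=; lia.
Qed.

Lemma swap_invP q (T : inc_tableau m n q) : 0 < q ->
  swap_inv q q (swaps q (rep_1_bullet (to_filling T))).
Proof.
case: q T => // q T _; rewrite /swaps [_.-1]/=.
suff H k : k <= q -> swap_inv q.+1 k.+1
    (foldl (fun G i => swap i G) (rep_1_bullet (to_filling T)) (iota 2 k)).
  exact: H.
elim: k => [|k IH] kq; first exact: swap_inv0.
have -> : iota 2 k.+1 = rcons (iota 2 k) k.+2.
  by rewrite -{1}[k.+1]addn1 iotaD cats1 add2n.
rewrite foldl_rcons.
by apply: swap_inv_step; [rewrite /= ltnS | apply: IH; exact: ltnW].
Qed.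

Lemma inc_tableau_gt0 q (T : inc_tableau m n q) b : 0 < q.
Proof.
case/andP: (entries_inc T) => /forallP/(_ b) T0 _.
by have /= := ltn_ord (T b); lia.
Qed.

Lemma promotion_entriesE q (T : inc_tableau m n q) :
  to_filling (promotion_entries T) = promotion_filling T.
Proof.
apply/ffunP=> b; have q0 := inc_tableau_gt0 T b.
have [_ bnd] := swap_invP T q0.
rewrite !ffunE; case E: (swaps _ _ b) => [v|] /=; rewrite inordK //.
by have := bnd _ _ E; lia.
Qed.

Lemma promotion_inc q (T : inc_tableau m n q) : increasing (promotion_entries T).
Proof.
have valE b : (promotion_entries T b : nat) =
    if swaps q (rep_1_bullet (to_filling T)) b is Some v then v.-1 else q.
  have := congr1 (fun F : filling m n => F b) (promotion_entriesE T).
  by rewrite /promotion_filling /= ffunE => /eqP; rewrite !ffunE;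
    case: (swaps _ _ b) => [v|] /= /eqP[].
apply/andP; split; apply/forallP => b; have q0 := inc_tableau_gt0 T b;
    have [inc bnd] := swap_invP T q0.
  rewrite valE; case E: (swaps _ _ b) => [v|] //.
  by have := bnd _ _ E; lia.
apply/forallP=> c; apply/implyP=> /inc; rewrite !valE.
case Eb: (swaps _ _ b) => [v|]; case Ec: (swaps _ _ c) => [w|] //=.
- by have := bnd _ _ Eb; have := bnd _ _ Ec; lia.
- by have := bnd _ _ Eb; lia.
- by have := bnd _ _ Ec; lia.
- by rewrite ltnn.
Qed.

Definition promotion_fun q (T : inc_tableau m n q) : inc_tableau m n q :=
  IncTableau (promotion_inc T).

Lemma promotion_inj q : injective (@promotion_fun q).
Proof.
move=> T U /(congr1 (fun V : inc_tableau m n q => to_filling V)) /=.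
rewrite !promotion_entriesE => E.
have {}E : rep_1_bullet (to_filling T) = rep_1_bullet (to_filling U).
  apply: (@swaps_inj q); apply/ffunP=> b; have q0 := inc_tableau_gt0 T b.
  have [_ bT] := swap_invP T q0; have [_ bU] := swap_invP U q0.
  have := congr1 (fun F : filling m n => F b) E.
  rewrite /promotion_filling /= !ffunE.
  case ET: (swaps _ _ b) => [v|]; case EU: (swaps _ _ b) => [w|] //= [].
  - by have := bT _ _ ET; have := bU _ _ EU => ? ? ?; congr Some; lia.
  - by have := bT _ _ ET; lia.
  - by have := bU _ _ EU; lia.
apply: val_inj; apply/ffunP => b; apply: val_inj => /=.
have := congr1 (fun F : filling m n => F b) E; rewrite /= !ffunE.
by case: eqP => [[->]|_]; case: eqP => [[->]|_] // [].
Qed.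

End PromotionFacts.

Definition promotion m n q : {perm inc_tableau m n q} :=
  perm (@promotion_inj m n q).

Section Homomesy.
Import GRing.Theory.
Local Open Scope ring_scope.

Definition wt m n q (S : {set box m n}) (T : inc_tableau m n q) : rat :=
  \sum_(b in S) (T b : nat)%:R.

(* Homomesy for the cyclic group generated by f, with orbit average a. *)
Definition homomesic (X : finType) (f : {perm X}) (w : X -> rat) (a : rat) :=
  forall O : {set X}, O \in porbits f -> (\sum_(U in O) w U) / #|O|%:R = a.

End Homomesy.

(* Main.v *)
Require Import Defs.
From mathcomp Require Import all_boot all_order all_algebra all_fingroup.
From mathcomp Require Import zify.

(* Follow a chain of boxes going right and weakly up with increasing entries.
   If T has such a chain with entries in (j, b], where 0 < j and b <= q, then
   P(T) has one of the same length with entries in (j - 1, b - 1]. The entries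
   > i of the last row of T form such a chain; its length therefore bounds from
   below the number of entries <= q - i in the first row of P^i(T).
   Hence T (rot180 b) > i implies (P^i T) b <= q - i for b in the first row,
   and by transposition also for b in the first column. Counting the pairs
   (U, i) with U in an orbit O gives, for every frame box b, the inequality
     \sum_(U in O) (U b + U (rot180 b)) <= (q + 1) |O|.
   The rotation-complement bijection of Inc^q shows that these inequalities add
   up to an equality over all orbits, so each of them is an equality. *)

Set Implicit Arguments.
Unset Strict Implicit.
Unset Printing Implicit Defensive.

(** * Chains of boxes under a single swap *)

Section Chains.
Variables m n : nat.
Implicit Types (f : nat -> nat -> nat) (p : nat * nat) (s : seq (nat * nat)).

Definition inside p := (0 < p.1 <= m) && (0 < p.2 <= n).

Definition supported f := forall r c, f r c != 0 -> inside (r, c).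

Definition strict f :=
  (forall r c d, 0 < r <= m -> 0 < c -> c < d <= n -> f r c < f r d) /\
  (forall r t c, 0 < c <= n -> 0 < r -> r < t <= m -> f r c < f t c).

(* A numeral v is coded by 2v; before [swap_i] a bullet, which behaves as an
   entry between i - 1 and i, is coded by 2i - 1, and after it by 2i + 1.
   Boxes have 1-based coordinates, and the code is 0 outside of the rectangle. *)
Definition swap_codes i f r c :=
  if f r c == i.*2 then
    if (f r.-1 c == i.*2.-1) || (f r c.-1 == i.*2.-1) then i.*2.+1 else i.*2
  else if f r c == i.*2.-1 then
    if (f r.+1 c == i.*2) || (f r c.+1 == i.*2) then i.*2 else i.*2.+1
  else f r c.

Definition ne_step f p p' :=
  [&& p.2 < p'.2, f p.1 p.2 < f p'.1 p'.2 & p'.1 <= p.1].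

(* Chains in the strict sense may break while promotion is in progress: the step
   to a box directly below a bullet, coded by [k], must be allowed as well. *)
Definition bullet_step k f p p' :=
  [&& p.2 < p'.2, f p.1 p.2 < f p'.1 p'.2 &
      (p'.1 <= p.1) || (p'.1 == p.1.+1) && (f p.1 p'.2 == k)].

Definition ranged k lo hi f p :=
  [&& inside p, f p.1 p.2 != k & lo <= f p.1 p.2 <= hi].

Lemma path_head (T : Type) (e : rel T) x y (s : seq T) :
  (forall z, e x z -> e y z) -> path e x s -> path e y s.
Proof. by case: s => //= z s E /andP[/E -> ->]. Qed.

Lemma swap_codes_high i f r c : i.*2 < f r c -> swap_codes i f r c = f r c.
Proof. by move=> h; rewrite /swap_codes; do 2!(case: eqP => ?; first lia). Qed.

Lemma swap_codes_low i f r c : f r c < i.*2.-1 -> swap_codes i f r c = f r c.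
Proof. by move=> h; rewrite /swap_codes; do 2!(case: eqP => ?; first lia). Qed.

(** A bullet to the right of [p] in its row would have a code larger than that of [p], hence larger
    than [k]. So a chain that has passed [k] makes ordinary steps only. *)
Lemma ne_path_of_bullet k f p s : strict f -> inside p -> k < f p.1 p.2 ->
  all inside s -> path (bullet_step k f) p s -> path (ne_step f) p s.
Proof.
move=> [fr fc]; elim: s p => //= y s IH p ip kp /andP[iy is_] /andP[py ys].
have lt : f p.1 p.2 < f y.1 y.2 by case/and3P: py.
rewrite (IH y) //; last by lia.
rewrite andbT; move: py; rewrite /bullet_step /ne_step.
case/and3P=> h1 h2 /orP[h3|/andP[_ /eqP h3]]; first by apply/and3P.
have := fr p.1 p.2 y.2; rewrite /inside in ip iy; lia.
Qed.

Lemma ne_path_gt M f p s : M <= f p.1 p.2 -> path (ne_step f) p s ->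
  all (fun y => M < f y.1 y.2) s.
Proof.
elim: s p => //= y s IH p Mp /andP[/and3P[_ h _] ps].
by rewrite (leq_ltn_trans Mp h) (IH y) // (leq_trans Mp) // ltnW.
Qed.

(** The swap fixes all codes above [2i], so only the starting box can change, and a new code of at
    most [2i] keeps it below the next box. *)
Lemma bullet_path_of_ne k i f p s :
  swap_codes i f p.1 p.2 = f p.1 p.2 \/ swap_codes i f p.1 p.2 <= i.*2 ->
  path (ne_step f) p s -> all (fun y => i.*2 < f y.1 y.2) s ->
  path (bullet_step k (swap_codes i f)) p s.
Proof.
elim: s p => //= y s IH p kp /andP[/and3P[h1 h2 h3] ys] /andP[iy is_].
have ey : swap_codes i f y.1 y.2 = f y.1 y.2 by apply: swap_codes_high.
rewrite IH //; last by left.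
by rewrite /bullet_step ey h1 h3 andbT /=; lia.
Qed.

(* The initial part of the chain lying in row [r.+1] is moved up to row [r]. *)
Lemma ne_path_up M hi f r c s : strict f -> inside (r, c) -> inside (r.+1, c) ->
  (forall d, c < d <= n -> M < f r d) ->
  all (fun p => [&& inside p, M < f p.1 p.2 & f p.1 p.2 <= hi]) s ->
  path (ne_step f) (r.+1, c) s ->
  exists s', [/\ size s' = size s,
    all (fun p => [&& inside p, M < f p.1 p.2 & f p.1 p.2 <= hi]) s' &
    path (ne_step f) (r, c) s'].
Proof.
move=> [fr fc]; elim: s c => [|[a d] s IH] c i1 i2 hM /=; first by exists [::].
move=> /andP[/and3P[iy My hy] als] /andP[/and3P[/= h1 h2 h3] ps].
have [ar|ar] := leqP a r.
  exists ((a, d) :: s); split=> //=; first by rewrite iy My hy als.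
  rewrite ps andbT /ne_step /= h1 ar andbT /=.
  have /= := fc r r.+1 c; rewrite /inside /= in i1 i2; lia.
have ? : a = r.+1 by lia.
subst a.
have id : inside (r, d) by rewrite /inside /= in i1 iy *; lia.
have [|s' [ss als' ps']] := IH d id iy _ als ps.
  by move=> e /andP[de en]; apply: hM; lia.
have Md : M < f r d by apply: hM; rewrite /inside /= in iy; lia.
exists ((r, d) :: s'); split=> /=; first by rewrite ss.
  rewrite id Md als' andbT /=.
  have := fc r r.+1 d; rewrite /inside /= in i1 iy hy; lia.
rewrite ps' andbT /ne_step /= h1 leqnn andbT /=.
have := fr r c d; rewrite /inside /= in i1 iy; lia.
Qed.

Definition good i hi f p := [&& inside p, i.*2 < f p.1 p.2 & f p.1 p.2 <= hi].

Lemma good_high i hi f s : all (good i hi f) s ->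
  all (fun p => i.*2 < f p.1 p.2) s.
Proof. by apply: sub_all => p /and3P[]. Qed.

(* A chain through the box [(r.+1, c)] below the bullet [(r, c)] is rerouted
   through [(r, c)] once this bullet has become an [i]. *)
Lemma chain_through_bullet i hi f r c s : 1 < i -> strict f -> supported f ->
  f r c = i.*2.-1 -> inside (r.+1, c) -> swap_codes i f r c = i.*2 ->
  path (ne_step f) (r.+1, c) s -> all (good i hi f) s ->
  exists s', [/\ size s' = size s, all (good i hi f) s' &
    path (bullet_step i.*2.+1 (swap_codes i f)) (r, c) s'].
Proof.
move=> i1 sf supf bu iy f'u oy sG; have [fr fc] := sf.
have iu : inside (r, c) by apply: supf; rewrite bu; clear -i1; lia.
have [/andP[r0 rm] /andP[c0 cn]] := andP iu; rewrite /= in r0 rm c0 cn.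
have [/andP[_ rm'] _] := andP iy; rewrite /= in rm'.
have use s' : size s' = size s -> all (good i hi f) s' ->
    path (ne_step f) (r, c) s' ->
    exists s', [/\ size s' = size s, all (good i hi f) s' &
      path (bullet_step i.*2.+1 (swap_codes i f)) (r, c) s'].
  move=> ss gs os; exists s'; split=> //.
  apply: bullet_path_of_ne; [by right; rewrite /= f'u | by [] |].
  exact: good_high gs.
(* Without an [i] to the right of the bullet, all later entries of row [r] exceed [i], and
   [ne_path_up] applies. *)
have [ni|ni] := eqVneq (f r c.+1) i.*2; last first.
  have [|s' [ss gs os]] := @ne_path_up i.*2 hi f r c s sf iu iy _ sG oy.
    move=> d /andP[cd dn].
    have lt1 : i.*2 < f r c.+1.
      have : f r c < f r c.+1 by apply: fr; clear -r0 rm c0 cd dn; lia.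
      by rewrite bu; clear -ni i1; lia.
    have [->//|dc] := eqVneq d c.+1.
    apply: (ltn_trans lt1); apply: fr; clear -r0 rm cd dn dc; lia.
  exact: use ss gs os.
case: s oy sG use => [|[a d] s] oy sG use; first exact: (use [::]).
case/andP: (oy) => /and3P[/= k1 k2 k3] os.
have [/and3P[iz hz zhi] sG'] := andP sG; rewrite /= in hz zhi.
have [ar|ar] := leqP a r.
  apply: (use ((a, d) :: s)) => //.
  rewrite -[path _ _ _]/(_ && _) os andbT /ne_step /= k1 ar andbT bu.
  by clear -hz i1; lia.
have ? : a = r.+1 by clear -ar k3; lia.
subst a.
have [_ /andP[_ dn]] := andP iz; rewrite /= in dn.
have iz' : inside (r.+1, c.+1).
  by rewrite /inside /= rm' /=; clear -k1 dn; lia.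
have vz' : i.*2 < f r.+1 c.+1.
  by rewrite -ni; apply: fc => //; clear -rm' k1 dn; lia.
have zz' : f r.+1 c.+1 <= f r.+1 d.
  case: (eqVneq d c.+1) => [->//|dc]; apply: ltnW; apply: fr => //.
  by clear -k1 dn dc; lia.
(* The [i] at [(r, c.+1)] becomes a bullet, which permits a bullet step from [(r, c)] to
   [(r.+1, c.+1)]. That box replaces [(r.+1, d)]; its entry is no larger, so the chain goes on as
   before. *)
have f'b : swap_codes i f r c.+1 = i.*2.+1.
  by rewrite /swap_codes ni eqxx /= bu eqxx orbT.
exists ((r.+1, c.+1) :: s); split=> //.
  apply/andP; split; last exact: sG'.
  by rewrite /good iz' /= vz' (leq_trans zz' zhi).
rewrite -[path _ _ _]/(_ && _); apply/andP; split.
  rewrite /bullet_step /= ltnSn f'u eqxx f'b eqxx orbT andbT /=.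
  by rewrite swap_codes_high.
apply: bullet_path_of_ne.
- by left; rewrite /= swap_codes_high.
- apply: path_head os => -[a b]; rewrite /ne_step /=; clear -zz' k1; lia.
- exact: good_high sG'.
Qed.

(* The chain may start at the virtual box [(m, 0)]. *)
Lemma chain_swap i lo hi f x s : 1 < i -> strict f -> supported f ->
  (forall r c, f r c != i.*2.+1) ->
  f x.1 x.2 < i.*2.-1 -> x = (m, 0) \/ (inside x /\ lo <= f x.1 x.2) ->
  path (bullet_step i.*2.-1 f) x s -> all (ranged i.*2.-1 lo hi f) s ->
  exists s', [/\ size s' = size s,
    path (bullet_step i.*2.+1 (swap_codes i f)) x s' &
    all (ranged i.*2.+1 lo hi (swap_codes i f)) s'].
Proof.
move=> i1 sf supf nb; have [fr fc] := sf; set f' := swap_codes i f.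
pose high p := i.*2 < f p.1 p.2.
have goodR s0 : lo <= i.*2 -> all (good i hi f) s0 ->
    all (ranged i.*2.+1 lo hi f') s0.
  move=> loi; apply: sub_all => p /and3P[ip hp ph].
  rewrite /ranged /f' swap_codes_high // ip nb ph andbT.
  by clear -loi hp; lia.
have highR s0 : all high s0 -> all (ranged i.*2.-1 lo hi f) s0 ->
    all (good i hi f) s0 /\ all (ranged i.*2.+1 lo hi f') s0.
  elim: s0 => //= p s0 IH /andP[hp /IH{}IH] /andP[/and3P[ip _ h] /IH[-> ->]].
  move: hp; rewrite /high => hp.
  by rewrite /ranged /good /f' swap_codes_high // hp ip nb h; case/andP: h => _ ->.
elim: s x => [|[r c] s IH] x xlt xlo /=; first by exists [::].
case/andP=> xy ps /andP[ry als].
have fx' : f' x.1 x.2 = f x.1 x.2 by apply: swap_codes_low.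
have [/= iy ny vy] := and3P ry.
have [/andP[r0 rm] /andP[c0 cn]] := andP iy; rewrite /= in r0 rm c0 cn.
have bul p : f p.1 p.2 = i.*2.-1 -> inside p.
  by move=> e; rewrite [p]surjective_pairing; apply: supf; rewrite e; clear -i1; lia.
have xc1 : x.2 < c by case/and3P: xy.
have xlast : f x.1 c = i.*2.-1 -> r = x.1.+1 -> i.*2.-1 < f r c.
  move=> e rx; have /andP[/andP[a _] _] := bul (x.1, c) e.
  by rewrite -e; apply: fc; rewrite ?c0 // rx ltnSn -rx.
(* Boxes before the bullets keep their codes, and none of them lies below a bullet, so the step to
   such a box is an ordinary one. *)
have [ylo|yhi] := ltnP (f r c) i.*2.-1.
  have loy : lo <= f r c by case/andP: vy.
  have [|s' [ss ps' als']] := IH (r, c) ylo _ ps als.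
    by right; split.
  have fy' : f' r c = f r c by apply: swap_codes_low.
  exists ((r, c) :: s'); split=> /=; first by rewrite ss.
    rewrite ps' andbT; move: xy; rewrite /bullet_step /= fx' fy'.
    case/and3P=> -> -> /orP[->//|/andP[/eqP rx /eqP bu]].
    by move: (xlast bu rx); rewrite ltnNge ltnW.
  rewrite als' andbT /ranged iy /= fy' vy andbT.
  by clear -ylo; lia.
have {}yhi : i.*2 <= f r c by clear -yhi ny; lia.
have oy : path (ne_step f) (r, c) s.
  apply: ne_path_of_bullet ps => //=; first by clear -yhi i1; lia.
  by apply: sub_all als => p /and3P[].
have sH : all high s by apply: (ne_path_gt _ oy).
have [sG sR] := highR _ sH als.
(* Here [y = (r, c)] is the first chain box holding at least [i], and all later ones hold more. In
   most cases [y] gives way to a box [p] that holds [i] after the swap. *)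
have through p s' : inside p -> f' p.1 p.2 = i.*2 -> lo <= i.*2 <= hi ->
    x.2 < p.2 -> p.1 <= x.1 -> size s' = size s -> all (good i hi f) s' ->
    path (bullet_step i.*2.+1 f') p s' ->
    exists s', [/\ size s' = (size s).+1,
      path (bullet_step i.*2.+1 f') x s' & all (ranged i.*2.+1 lo hi f') s'].
  move=> ip fp /andP[loi hii] cp rp ss gs ps'; exists (p :: s').
  split; rewrite /= ?ss // ?ps' ?goodR // ?andbT.
    by rewrite /bullet_step fp fx' cp rp andbT /=; clear -xlt i1; lia.
  by rewrite /ranged ip fp loi hii /= andbT; clear; lia.
have /and3P[_ xy1 xy2] := xy; rewrite /= in xy1 xy2.
have [yi|yi] := eqVneq (f r c) i.*2; last first.
  have yhi' : i.*2 < f r c by clear -yi yhi; lia.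
  have fy' : f' r c = f r c by apply: swap_codes_high.
  have ps' : path (bullet_step i.*2.+1 f') (r, c) s.
    by apply: bullet_path_of_ne => //; left.
  have Rs : all (ranged i.*2.+1 lo hi f') ((r, c) :: s).
    by apply/andP; split=> //; rewrite /ranged iy /= fy' nb.
  case/orP: xy2 => [h3|/andP[/eqP h3 /eqP bu]].
    exists ((r, c) :: s); split=> //=.
    by rewrite ps' andbT /bullet_step /= xc1 h3 fx' fy' xy1.
  (* The box below this bullet is [y], whose entry exceeds [i], so only an [i] to its right can turn
     the bullet into an [i]. Otherwise it stays a bullet and the same bullet step remains valid. *)
  have f'u : f' x.1 c = if f x.1 c.+1 == i.*2 then i.*2 else i.*2.+1.
    rewrite /f' /swap_codes bu eqxx -h3 (gtn_eqF yhi') /=.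
    by case: eqP => // e; clear -e i1; lia.
  move: f'u; case: (f x.1 c.+1 == i.*2) => f'u; last first.
    exists ((r, c) :: s); split=> //=.
    by rewrite ps' andbT /bullet_step /= xc1 fx' fy' xy1 h3 f'u !eqxx orbT.
  (* From the virtual box a bullet step would lead to row [m + 1]. *)
  have lox : lo <= f x.1 x.2.
    by case: xlo => [xe|[] //]; move: rm; rewrite h3 xe /= ltnn.
  subst r.
  have [s' [ss gs ps'']] := chain_through_bullet i1 sf supf bu iy f'u oy sG.
  apply: (through (x.1, c) s') => //; first exact: bul.
  by clear -lox xlt yhi' vy; lia.
rewrite yi in vy.
(* Now [y] holds [i]. It becomes a bullet if there is one above it or to its left; that neighbour
   then becomes [i] and takes its place in the chain. *)
have [bu|nbu] := eqVneq (f r.-1 c) i.*2.-1.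
  have iu : inside (r.-1, c) by apply: bul.
  have f'u : f' r.-1 c = i.*2.
    rewrite /f' /swap_codes bu eqxx prednK // yi eqxx /=.
    by case: eqP => // e; clear -e i1; lia.
  rewrite -(prednK r0) in iy oy xy2.
  have [s' [ss gs ps']] := chain_through_bullet i1 sf supf bu iy f'u oy sG.
  apply: (through (r.-1, c) s') => //=.
  by case/orP: xy2 => [/ltnW|/andP[/eqP[->]]].
have rx : r <= x.1.
  case/orP: xy2 => // /andP[/eqP h e].
  by rewrite h /= e in nbu.
have [bl|nbl] := eqVneq (f r c.-1) i.*2.-1.
  have il : inside (r, c.-1) by apply: bul.
  have f'l : f' r c.-1 = i.*2.
    rewrite /f' /swap_codes bl eqxx prednK // yi eqxx orbT /=.
    by case: eqP => // e; clear -e i1; lia.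
  have [_ /andP[cl _]] := andP il; rewrite /= in cl.
  apply: (through (r, c.-1) s) => //=; last first.
    apply: bullet_path_of_ne => //; first by right; rewrite /= -/f' f'l.
    apply: path_head oy => -[a b]; rewrite /ne_step /= yi bl; clear; lia.
  (* If [x] were in column [c.-1], it would lie at or below the bullet [(r, c.-1)], although its
     code is smaller. The virtual box is excluded because [c.-1] is positive. *)
  rewrite ltn_neqAle; apply/andP; split; last by clear -xc1; lia.
  apply/eqP => xc; move: xlt; rewrite ltnNge => /negP; apply.
  case: xlo => [xe|[/andP[/andP[_ xm] _] _]].
    by move: cl; rewrite -xc xe.
  rewrite -bl xc; have [->//|rx'] := eqVneq r x.1.
  apply: ltnW; apply: fc => //; first by case/andP: il.
  by rewrite xm andbT ltn_neqAle rx' rx.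
have f'y : f' r c = i.*2.
  by rewrite /f' /swap_codes yi eqxx (negbTE nbu) (negbTE nbl).
apply: (through (r, c) s) => //.
by apply: bullet_path_of_ne => //; right; rewrite /= -/f' f'y.
Qed.

(** * Chains under a full promotion *)

(** [F k] is the coded filling after [swap_k], and [F 1] the one before all swaps, whence the bullet
    code 3. A relation on coordinate functions makes the symmetry under transposition immediate. *)
Definition promotes q (g g' : nat -> nat -> nat) :=
  exists F : nat -> nat -> nat -> nat,
  [/\ forall r c, F 1 r c = if g r c == 1 then 3 else (g r c).*2,
      forall k, 0 < k < q -> F k.+1 =2 swap_codes k.+1 (F k),
      forall k, 0 < k <= q -> [/\ strict (F k), supported (F k) &
        forall r c, (F k r c == k.*2.+1) || ~~ odd (F k r c)] &
      forall r c, g' r c = if F q r c == q.*2.+1 then q else (F q r c)./2.-1].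

Definition valued lo hi f p := inside p && (lo < f p.1 p.2 <= hi).

Lemma path_transfer (T : Type) (e e' : rel T) (P : pred T) x (t : seq T) :
  (forall y z, y = x \/ P y -> P z -> e y z -> e' y z) ->
  all P t -> path e x t -> path e' x t.
Proof.
elim: t x => //= y t IH x E /andP[Py Pt] /andP[xy yt].
rewrite E //=; last by left.
by apply: IH => // z w zy; apply: E; right; case: zy => [->|].
Qed.

Lemma eq_bullet_step k f g : f =2 g -> bullet_step k f =2 bullet_step k g.
Proof. by move=> e p p'; rewrite /bullet_step !e. Qed.

Lemma eq_ranged k lo hi f g : f =2 g -> ranged k lo hi f =1 ranged k lo hi g.
Proof. by move=> e p; rewrite /ranged !e. Qed.

(** Iterate [chain_swap] over all swaps. Entries in [(j, b]] have codes from [2j + 2] to [2b], and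
    the final decrement shifts the interval by one. *)
Lemma promotes_chain q g g' j b s : 0 < j -> b <= q -> promotes q g g' ->
  path (ne_step g) (m, 0) s -> all (valued j b g) s ->
  exists s', [/\ size s' = size s, path (ne_step g') (m, 0) s' &
    all (valued j.-1 b.-1 g') s'].
Proof.
move=> j0 bq [F [F1 FS Fok Fq]] ps als.
case: s ps als => [|y s] ps als; first by exists [::].
have q0 : 0 < q.
  case/andP: als => /andP[_ h] _; clear -h j0 bq; lia.
have F0 k : 0 < k <= q -> F k m 0 = 0.
  move=> /Fok[_ supk _]; apply/eqP; apply: contraT => /supk.
  by rewrite /inside /= andbF.
have chain k : 0 < k <= q -> exists s', [/\ size s' = (size s).+1,
    path (bullet_step k.*2.+1 (F k)) (m, 0) s' &
    all (ranged k.*2.+1 j.*2.+2 b.*2 (F k)) s'].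
  case: k => // k; elim: k => [|k IH] /= kq.
    (* Chain entries exceed [j >= 1], so none of them becomes a bullet at the start. *)
    have F1s p : valued j b g p -> F 1 p.1 p.2 = (g p.1 p.2).*2.
      move=> /andP[_ /andP[jp _]]; rewrite F1; case: eqP => // e.
      by move: jp; rewrite e ltnNge j0.
    have F1m : F 1 m 0 = (g m 0).*2.
      have := F0 1 q0; rewrite F1; by case: eqP.
    exists (y :: s); split=> //; last first.
      apply: sub_all als => p pv; rewrite /ranged F1s //.
      by case/andP: pv => -> h; clear -h; lia.
    apply: path_transfer als ps => x p xe pv /and3P[h1 h2 h3].
    rewrite /bullet_step h1 h3 (F1s p) //.
    have -> : F 1 x.1 x.2 = (g x.1 x.2).*2 by case: xe => [->|/F1s].
    by rewrite ltn_double h2.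
  have kq' : 0 < k.+1 <= q by rewrite /= ltnW.
  have [s' [ss ps' als']] := IH (ltnW kq).
  have [sk supk parity] := Fok _ kq'.
  have [|||s2 [ss2 ps2 als2]] :=
    @chain_swap k.+2 j.*2.+2 b.*2 (F k.+1) (m, 0) s' isT sk supk _ _ _ ps' als'.
  - move=> r c; have := parity r c; apply: contraL => /eqP->.
    by rewrite /= odd_double; apply/norP; split=> //; clear; lia.
  - by rewrite /= F0 //; clear; lia.
  - by left.
  exists s2; rewrite ss2 ss; split=> //.
    by rewrite (eq_path (eq_bullet_step _ (FS _ _))).
  by rewrite (eq_all (eq_ranged _ _ _ (FS _ _))).
have qq : 0 < q <= q by rewrite q0 /=.
have [s' [ss ps' als']] := chain q qq.
have [[fr fc] supq parity] := Fok q qq.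
have val p : ranged q.*2.+1 j.*2.+2 b.*2 (F q) p ->
    F q p.1 p.2 = (g' p.1 p.2).+1.*2 /\ valued j.-1 b.-1 g' p.
  move=> /and3P[ip np hp]; have := parity p.1 p.2; rewrite (negbTE np) /= => ev.
  rewrite /valued ip Fq (negbTE np) /=; clear -hp ev j0.
  by split; lia.
exists s'; split=> //; last by apply: sub_all als' => p /val[].
apply: path_transfer als' ps' => x p xe rp.
have {}xe : F q x.1 x.2 = 0 /\ g' x.1 x.2 = 0 \/
    F q x.1 x.2 = (g' x.1 x.2).+1.*2.
  by case: xe => [->|/val[]]; [left; rewrite Fq F0 | right].
have [pe /andP[ip vp]] := val _ rp.
case/and3P=> h1 h2 h3; rewrite /ne_step h1 /=; apply/andP; split.
  by move: h2; rewrite pe; case: xe => [[-> ->]|->]; clear -vp; lia.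
(* A bullet step would end below a bullet of code [2q + 1], but chain codes are at most
   [2b <= 2q]. *)
case/orP: h3 => // /andP[/eqP e /eqP bu].
have [/andP[_ pm] cp] := andP ip.
have ix : inside (x.1, p.2) by apply: supq; rewrite bu.
have : F q x.1 p.2 < F q p.1 p.2.
  by apply: fc => //; [case/andP: ix => /andP[] | rewrite pm e ltnSn].
by case/and3P: rp => _ _ /andP[_]; rewrite bu; clear -bq; lia.
Qed.

Lemma ne_path_last_col f p s : path (ne_step f) p s -> p.2 + size s <= (last p s).2.
Proof.
elim: s p => [|y s IH] p /=; first by rewrite addn0.
by case/andP=> /and3P[py _ _] /IH; apply: leq_trans; rewrite addnS -addSn leq_add2r.
Qed.

Lemma ne_path_row f r c d l : strict f -> 0 < r <= m -> c < d ->
  d + l <= n.+1 -> (0 < l -> f r c < f r d) ->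
  path (ne_step f) (r, c) [seq (r, e) | e <- iota d l].
Proof.
move=> [fr _] rm; elim: l c d => //= l IH c d cd dl /(_ isT) lt.
rewrite {1}/ne_step /= cd lt leqnn; apply: IH => //; first by rewrite addSnnS.
by move=> l0; apply: fr => //; clear -l0 cd dl; lia.
Qed.

(** The last [k] boxes of row [m] form a chain with entries in [(i, q]], and [i] promotions turn it
    into one with entries in [(0, q - i]]. Its end lies weakly southeast of [(1, k)] and so bounds
    the entry there. *)
Lemma first_row_of_last_row q (G : nat -> nat -> nat -> nat) i k :
  (forall t, promotes q (G t) (G t.+1)) -> (forall t, strict (G t)) ->
  G 0 m 0 = 0 -> 0 < m -> 0 < k <= n -> i < G 0 m (n - k).+1 ->
  G 0 m n <= q -> G i 1 k <= q - i.
Proof.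
move=> Gp Gs G0 m0 /andP[k0 kn] ilt Gq.
pose s := [seq (m, c) | c <- iota (n - k).+1 k].
have s_mem p : p \in s -> exists2 c, p = (m, c) & n - k < c <= n.
  case/mapP=> c; rewrite mem_iota => h ->; exists c => //.
  by clear -h kn; lia.
have [r0 c0] := Gs 0.
have s_val : all (valued i q (G 0)) s.
  apply/allP => p /s_mem[c -> /andP[c1 c2]].
  rewrite /valued /inside /= m0 leqnn c2 (leq_ltn_trans (leq0n _) c1) /=.
  apply/andP; split.
    apply: (leq_trans ilt).
    have [->//|ne] := eqVneq c (n - k).+1.
    by apply/ltnW/r0; rewrite ?m0 ?leqnn //; clear -ne c1 c2; lia.
  apply: leq_trans Gq; have [->//|ne] := eqVneq c n.
  by apply/ltnW/r0; rewrite ?m0 ?leqnn //; clear -ne c1 c2; lia.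
have s_path : path (ne_step (G 0)) (m, 0) s.
  apply: ne_path_row => //; rewrite ?m0 ?leqnn //; first by clear -kn; lia.
  by move=> _; rewrite G0; apply: leq_ltn_trans ilt.
have [s' [ss ps' als']] : exists s', [/\ size s' = k,
    path (ne_step (G i)) (m, 0) s' & all (valued 0 (q - i) (G i)) s'].
  suff /(_ i (leqnn i)) : forall t, t <= i -> exists s', [/\ size s' = k,
      path (ne_step (G t)) (m, 0) s' & all (valued (i - t) (q - t) (G t)) s'].
    by rewrite subnn.
  elim=> [_|t IH ti].
    by exists s; rewrite !subn0 size_map size_iota.
  have [s1 [ss1 ps1 als1]] := IH (ltnW ti).
  have [||s2 [ss2 ps2 als2]] := promotes_chain _ _ (Gp t) ps1 als1.
  - by rewrite subn_gt0.
  - exact: leq_subr.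
  by exists s2; rewrite !subnS ss2 ss1.
have [/= fr fc] := Gs i.
have [p [/andP[/andP[p0 pm] /andP[pc pn]] vp kp]] :
    exists p, [/\ inside p, G i p.1 p.2 <= q - i & k <= p.2].
  (* Each of the [k] steps moves right from column 0, so the last box is in column [k] or later. *)
  exists (last (m, 0) s'); have := ne_path_last_col ps'; rewrite ss add0n.
  case: s' als' ss {ps'} => [_ ss|y s' als' _ ->]; first by rewrite -ss in k0.
  by have /andP[-> /andP[_ ->]] := allP als' _ (mem_last y s').
apply: leq_trans vp; apply: (@leq_trans (G i 1 p.2)).
  have [->//|ne] := eqVneq k p.2.
  by apply/ltnW/fr => //; rewrite ?m0 // ltn_neqAle ne kp.
have [->//|ne] := eqVneq 1 p.1.
by apply/ltnW/fc; rewrite ?pc // ltn_neqAle ne p0.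
Qed.
End Chains.

(** * Symmetry of promotion under transposition *)

Section Transposition.
Variables m n : nat.
Let tr (f : nat -> nat -> nat) r c := f c r.

Lemma insideC r c : inside n m (c, r) = inside m n (r, c).
Proof. by rewrite /inside andbC. Qed.

Lemma strict_tr f : strict m n f -> strict n m (tr f).
Proof. by case=> fr fc; split=> a b c ? ? ?; [apply: fc | apply: fr]. Qed.

Lemma promotes_tr q g g' : promotes m n q g g' -> promotes n m q (tr g) (tr g').
Proof.
case=> F [F1 FS Fok Fq]; exists (fun k => tr (F k)); split.
- by move=> r c; apply: F1.
- by move=> k kq r c; rewrite /tr FS // /swap_codes orbC [(_ == k.+1.*2) || _]orbC.
- move=> k /Fok[sk supk par]; split; first exact: strict_tr.
    by move=> r c /supk; rewrite insideC.
  by move=> r c; apply: par.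
- by move=> r c; apply: Fq.
Qed.
End Transposition.

(** * From fillings of boxes to coded functions on coordinates *)

Section Spread.
Variables m n : nat.
Implicit Types (h : box m n -> nat) (b : box m n).

Definition spread h (r c : nat) : nat :=
  if [pick b : box m n | (b.1.+1 == r) && (b.2.+1 == c)] is Some b
  then h b else 0.

Lemma spreadE h b : spread h b.1.+1 b.2.+1 = h b.
Proof.
rewrite /spread; case: pickP => [d|/(_ b)]; last by rewrite !eqxx.
rewrite !eqSS [d]surjective_pairing [b in RHS]surjective_pairing /=.
by case/andP=> /eqP/val_inj-> /eqP/val_inj->.
Qed.

Lemma insideP r c : inside m n (r, c) ->
  exists b, r = b.1.+1 /\ c = b.2.+1.
Proof.
case: r c => [|r] [|c] /andP[] //= rm cn.
by exists (Ordinal rm, Ordinal cn).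
Qed.

Lemma spread_supported h : supported m n (spread h).
Proof.
move=> r c; rewrite /spread; case: pickP => // d /andP[/eqP <- /eqP <-] _.
by rewrite /inside /= !ltn_ord.
Qed.

Lemma spread_strict h : (forall b c, before b c -> h b < h c) ->
  strict m n (spread h).
Proof.
move=> inc; split=> [r c d rm c0 /andP[cd dn]|r t c cn r0 /andP[rt tm]].
  have [|b [rb cb]] := @insideP r c; first by rewrite /inside rm /= c0; lia.
  have [|b' [rb' cb']] := @insideP r d; first by rewrite /inside rm /= dn; lia.
  rewrite {1}rb cb rb' cb' !spreadE; apply: inc.
  by rewrite /before /row_before -val_eqE /=; lia.
have [|b [rb cb]] := @insideP r c; first by rewrite /inside cn andbT /= r0; lia.
have [|b' [rb' cb']] := @insideP t c; first by rewrite /inside cn andbT /= tm; lia.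
rewrite {1}cb rb rb' cb' !spreadE; apply: inc.
by rewrite /before /col_before -val_eqE /=; lia.
Qed.

Definition code k (F : filling m n) b := if F b is Some v then v.*2 else k.*2.+1.

(** The first edge of a path leaving [b] already gives a neighbour, so the condition on components
    in [swap] is local. *)
Lemma component_gt1 i (F : filling m n) b :
  (1 < #|component i F b|) = [exists c, swap_edge i F b c].
Proof.
have irr c : swap_edge i F c c = false.
  by rewrite /swap_edge /edge_adjacent; apply/negP; lia.
apply/idP/existsP => [|[c bc]]; last first.
  by apply: swap_edge_big (bc); apply: contraTneq bc => ->; rewrite irr.
rewrite (cardsD1 b) !inE connect0 ltnS => /card_gt0P[c]; rewrite !inE.
case/andP=> cb /connectP[[|d p] /= bp ce]; first by rewrite ce eqxx in cb.
by exists d; case/andP: bp.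
Qed.

(** Codes increase strictly to the right and down. Hence a swappable neighbour of a numeral [k.+1]
    is a bullet above or to the left, and one of a bullet is a [k.+1] below or to the right: the
    tests made by [swap_codes]. *)
Lemma code_swap q k (F : filling m n) : 0 < k -> swap_inv q k F ->
  spread (code k.+1 (swap k.+1 F)) =2 swap_codes k.+1 (spread (code k F)).
Proof.
move=> k0 [inc bnd] r c.
(* [code] is convertible with the local [key] inside [swap_inv]. *)
have {}inc b d : before b d -> code k F b < code k F d by exact: inc.
have [/insideP[b [-> ->]]|out] := boolP (inside m n (r, c)); last first.
  have out0 h : spread h r c = 0.
    by apply/eqP; apply: contraNT out => /spread_supported.
  by rewrite out0 /swap_codes out0.
have none d : (code k F d == k.*2.+1) = (F d == None).
  rewrite /code; case: (F d) => [v|] /=; rewrite ?eqxx //.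
  by apply/negbTE/eqP => e; clear -e; lia.
have some d v : (code k F d == v.*2) = (F d == Some v).
  rewrite /code; case: (F d) => [w|] /=; last first.
    by apply/negbTE/eqP => e; clear -e; lia.
  by rewrite (inj_eq double_inj).
have nbr r' c' v : v != 0 -> (spread (code k F) r' c' == v) =
    [exists d : box m n, [&& d.1.+1 == r', d.2.+1 == c' & code k F d == v]].
  move=> v0; apply/eqP/existsP => [e|[d /and3P[/eqP <- /eqP <- /eqP]]]; last first.
    by rewrite spreadE.
  have /insideP[d [rd cd]] : inside m n (r', c').
    by apply: (@spread_supported (code k F)); rewrite e.
  by exists d; rewrite rd cd !eqxx -e rd cd spreadE /=.
have adjE (d : box m n) : edge_adjacent b d =
    ((d.1.+1 == b.1) && (d.2.+1 == b.2.+1) ||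
     (d.1.+1 == b.1.+1) && (d.2.+1 == b.2)) ||
    ((d.1.+1 == b.1.+2) && (d.2.+1 == b.2.+1) ||
     (d.1.+1 == b.1.+1) && (d.2.+1 == b.2.+2)).
  by rewrite /edge_adjacent -!val_eqE /=; clear; lia.
have before_db (d : box m n) : (d.1.+1 == b.1) && (d.2.+1 == b.2.+1) ||
    (d.1.+1 == b.1.+1) && (d.2.+1 == b.2) -> code k F d < code k F b.
  move=> h; apply: inc; move: h.
  by rewrite /before /row_before /col_before -!val_eqE /=; clear; lia.
have before_bd (d : box m n) : (d.1.+1 == b.1.+2) && (d.2.+1 == b.2.+1) ||
    (d.1.+1 == b.1.+1) && (d.2.+1 == b.2.+2) -> code k F b < code k F d.
  move=> h; apply: inc; move: h.
  by rewrite /before /row_before /col_before -!val_eqE /=; clear; lia.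
have nbr2 r1 c1 r2 c2 v : v != 0 ->
    (spread (code k F) r1 c1 == v) || (spread (code k F) r2 c2 == v) =
    [exists d : box m n, ((d.1.+1 == r1) && (d.2.+1 == c1) ||
      (d.1.+1 == r2) && (d.2.+1 == c2)) && (code k F d == v)].
  move=> v0; rewrite !nbr //; apply/orP/existsP => [[]/existsP[d]|[d]].
  - by case/and3P=> a1 a2 a3; exists d; rewrite a1 a2 a3.
  - by case/and3P=> a1 a2 a3; exists d; rewrite a1 a2 a3 orbT.
  case/andP=> /orP[] /andP[a1 a2] a3; [left|right]; apply/existsP; exists d.
    by rewrite a1 a2 a3.
  by rewrite a1 a2 a3.
rewrite /swap_codes !spreadE some none !nbr2 // {1}/code ffunE component_gt1.
have swE d : swappable k.+1 F d = (code k F d == k.*2.+1) || (code k F d == k.+1.*2).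
  by rewrite none some.
have [Fb|Fb] := eqVneq (F b) (Some k.+1).
  have cb : code k F b = k.+1.*2 by rewrite /code Fb.
  rewrite swE cb eqxx orbT Fb /=; set e1 := [exists _, _]; set e2 := [exists _, _].
  suff -> : e1 = e2 by case: e2.
  apply: eq_existsb => d; rewrite /swap_edge !swE cb eqxx orbT adjE /=.
  have := @before_db d; have := @before_bd d; rewrite cb.
  case: (_ || _); case: (_ || _) => /= h1 h2; rewrite ?andbT ?andbF //.
  - by have := h1 isT; have := h2 isT; clear; lia.
  - by have := h1 isT; clear; lia.
  - by have := h2 isT; clear; lia.
rewrite swE some none (negbTE Fb) orbF.
have [Fn|Fn] := eqVneq (F b) None => /=; last first.
  by rewrite /code; case: (F b) Fn.
have cb : code k F b = k.*2.+1 by rewrite /code Fn.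
rewrite Fn.
set e1 := [exists _, _]; set e2 := [exists _, _].
suff -> : e1 = e2 by case: e2.
apply: eq_existsb => d; rewrite /swap_edge !swE cb eqxx adjE /=.
have := @before_db d; have := @before_bd d; rewrite cb.
case: (_ || _); case: (_ || _) => /= h1 h2; rewrite ?andbT ?andbF //.
- by have := h1 isT; have := h2 isT; clear; lia.
- by have := h1 isT; clear; lia.
- by have := h2 isT; clear; lia.
Qed.
End Spread.

(** * Promotion of tableaux satisfies [promotes] *)

Section PromotionRelation.
Variables m n q : nat.
Hypothesis q0 : 0 < q.
Implicit Types T : inc_tableau m n q.

Lemma spread_map (phi : nat -> nat) (h h' : box m n -> nat) : phi 0 = 0 ->
  (forall b, h' b = phi (h b)) -> forall r c, spread h' r c = phi (spread h r c).
Proof. by move=> phi0 e r c; rewrite /spread; case: pickP. Qed.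

Definition swap_state T k : filling m n :=
  foldl (fun G i => swap i G) (rep_1_bullet (to_filling T)) (iota 2 k.-1).

Lemma swap_stateS T k : 0 < k -> swap_state T k.+1 = swap k.+1 (swap_state T k).
Proof.
case: k => // k _; rewrite /swap_state -[k.+2.-1]addn1.
by rewrite iotaD foldl_cat add2n.
Qed.

Lemma swap_state_inv T k : 0 < k <= q -> swap_inv q k (swap_state T k).
Proof.
case: k => // k; elim: k => [_|k IH kq]; first exact: swap_inv0.
by rewrite swap_stateS //; apply: swap_inv_step => //; apply/IH/ltnW.
Qed.

Lemma promotion_fun_code T b : promotion_fun T b =
  (if code q (swap_state T q) b == q.*2.+1 then q
   else (code q (swap_state T q) b)./2.-1) :> nat.
Proof.
have := congr1 (fun F : filling m n => F b) (promotion_entriesE T).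
rewrite /promotion_filling /swaps -/(swap_state T q) !ffunE /code.
case: (swap_state T q b) => [v|] /= [->]; last by rewrite eqxx.
by rewrite doubleK; case: eqP => // e; lia.
Qed.

Lemma promotion_promotes T : promotes m n q (spread (fun b => T b : nat))
  (spread (fun b => promotion_fun T b : nat)).
Proof.
exists (fun k => spread (code k (swap_state T k))); split.
- apply: (spread_map (phi := fun x => if x == 1 then 3 else x.*2)) => // b.
  rewrite /code /swap_state /= !ffunE.
  by case: (T b == 1 :> nat) / eqP => [->|ne] //; case: eqP => // -[].
- move=> k /andP[k0 kq]; rewrite swap_stateS //; apply: code_swap => //.
  by apply: swap_state_inv; rewrite k0 ltnW.
- move=> k kq; have [inc _] := swap_state_inv T kq; split.
  + exact: spread_strict inc.
  + exact: spread_supported.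
  + move=> r c; rewrite /spread; case: pickP => [b _|_]; last by rewrite orbT.
    by rewrite /code; case: (swap_state T k b) => [v|];
      rewrite ?odd_double ?orbT ?eqxx.
- apply: (spread_map (phi := fun x => if x == q.*2.+1 then q else x./2.-1)) => //.
  exact: promotion_fun_code.
Qed.
End PromotionRelation.

(** * Sums over unions of orbits *)

Section OrbitSums.
Variables m n q : nat.
Hypothesis q0 : 0 < q.
Implicit Types T U : inc_tableau m n q.

Lemma rot180K : involutive (@rot180 m n).
Proof. by case=> i j; rewrite /rot180 /= !rev_ordK. Qed.

Lemma before_rot180 (b c : box m n) : before (rot180 b) (rot180 c) = before c b.
Proof.
have := ltn_ord b.1; have := ltn_ord b.2; have := ltn_ord c.1.
have := ltn_ord c.2; rewrite /before /row_before /col_before -!val_eqE /=; lia.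
Qed.

Lemma entry_bounds T b : 0 < T b <= q.
Proof. by case/andP: (entries_inc T) => /forallP-> _; rewrite -ltnS ltn_ord. Qed.

Lemma entry_lt T b c : before b c -> T b < T c.
Proof. by case/andP: (entries_inc T) => _ /forallP/(_ b)/forallP/(_ c)/implyP. Qed.

Definition complement_entries T : {ffun box m n -> 'I_q.+1} :=
  [ffun b => inord (q.+1 - T (rot180 b))].

Lemma complement_entriesE T b : complement_entries T b = q.+1 - T (rot180 b) :> nat.
Proof. by rewrite ffunE inordK //; have := entry_bounds T (rot180 b); lia. Qed.

(** Rotation reverses the order of boxes, and subtraction from [q + 1] reverses that of the
    entries. *)
Lemma complement_inc T : increasing (complement_entries T).
Proof.
apply/andP; split; apply/forallP=> b.
  by rewrite complement_entriesE; have := entry_bounds T (rot180 b); lia.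
apply/forallP=> c; apply/implyP; rewrite -before_rot180 => /(@entry_lt T).
rewrite !complement_entriesE.
by have := entry_bounds T (rot180 b); have := entry_bounds T (rot180 c); lia.
Qed.

Definition complement T : inc_tableau m n q := IncTableau (complement_inc T).

Lemma complementK : involutive complement.
Proof.
move=> T; apply: val_inj; apply/ffunP=> b; apply: val_inj => /=.
rewrite complement_entriesE /= complement_entriesE rot180K.
by rewrite subKn // ltnW // ltn_ord.
Qed.

(** For [b] in the first row and 1-based column [k], [rot180 b] is in the last row and column
    [n - k + 1], as in [first_row_of_last_row]. The first column follows by transposition. *)
Lemma promotion_edge T i (b : box m n) : (b.1 == 0 :> nat) || (b.2 == 0 :> nat) ->
  i < T (rot180 b) -> ((promotion m n q ^+ i)%g T) b <= q - i.
Proof.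
pose G t := spread (fun b => ((promotion m n q ^+ t)%g T) b : nat).
have Gp t : promotes m n q (G t) (G t.+1).
  rewrite /G expgSr permM [promotion m n q _]permE.
  exact: promotion_promotes.
have Gs t : strict m n (G t) by apply: spread_strict; apply: entry_lt.
have G0 r c : ~~ inside m n (r, c) -> G 0 r c = 0.
  by move=> out; apply/eqP; apply: contraNT out => /spread_supported.
have Gq r c : G 0 r c <= q.
  have [/insideP[d [-> ->]]|/G0-> //] := boolP (inside m n (r, c)).
  by rewrite /G spreadE; case/andP: (entry_bounds ((promotion m n q ^+ 0)%g T) d).
have Gb : G 0 (m - b.1) (n - b.2) = T (rot180 b).
  have /= := spreadE (fun b => ((promotion m n q ^+ 0)%g T) b : nat) (rot180 b).
  by rewrite !subnSK ?ltn_ord // /G => ->; rewrite expg0 perm1.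
have Gi : G i b.1.+1 b.2.+1 = (promotion m n q ^+ i)%g T b.
  by rewrite /G spreadE.
rewrite -Gb -Gi => /orP[] /eqP ->.
- rewrite subn0 -[n - b.2]subnSK ?ltn_ord // => lt.
  apply: (first_row_of_last_row Gp Gs) => //; first by rewrite G0 // /inside andbF.
    by apply: leq_ltn_trans (ltn_ord b.1).
  exact: ltn_ord.
- rewrite subn0 -[m - b.1]subnSK ?ltn_ord // => lt.
  apply: (first_row_of_last_row (fun t => promotes_tr (Gp t))
    (fun t => strict_tr (Gs t))) => //.
  + by rewrite G0.
  + by apply: leq_ltn_trans (ltn_ord b.2).
  + exact: ltn_ord.
Qed.

Lemma sum_ltn_below N x : \sum_(j < N) (j < x : nat) = minn N x.
Proof.
by elim: N => [|N IH]; rewrite ?big_ord0 ?min0n // big_ord_recr /= IH; lia.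
Qed.

Lemma sum_ltn_above N x : \sum_(j < N) (N - j < x : nat) = minn N x.-1.
Proof.
elim: N => [|N IH]; first by rewrite big_ord0 min0n.
by rewrite big_ord_recl /= (eq_bigr _ (fun j _ => erefl)) IH; lia.
Qed.

(** Unions of orbits are allowed so that the complement of an orbit is covered too. *)
Definition stable (O : {set inc_tableau m n q}) :=
  forall U, (promotion m n q U \in O) = (U \in O).

(** For each [j], invariance of [O] replaces [U b] by its value after [q - j] promotions. By
    [promotion_edge], that value exceeds [j] only if [U (rot180 b) <= q - j], so each pair [(U, j)]
    contributes at most 1. *)
Lemma sum_edge_le (O : {set inc_tableau m n q}) (b : box m n) : stable O ->
  (b.1 == 0 :> nat) || (b.2 == 0 :> nat) ->
  \sum_(U in O) (U b + U (rot180 b)) <= q.+1 * #|O|.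
Proof.
move=> stO edge; set P := promotion m n q in stO.
have stX t U : ((P ^+ t)%g U \in O) = (U \in O).
  by elim: t => [|t IH]; rewrite ?expg0 ?perm1 // expgSr permM stO.
have shift j : \sum_(U in O) (j < U b : nat) =
    \sum_(U in O) (j < (P ^+ (q - j))%g U b : nat).
  by rewrite (reindex_inj (@perm_inj _ (P ^+ (q - j))%g)) /=; apply: eq_bigl.
(* The thresholds [q - j] run over 1 to [q] and omit 0, so the second sum is [U (rot180 b) - 1];
   hence the summand 1. *)
have E U : U b + U (rot180 b) = \sum_(j < q) (j < U b : nat) +
    \sum_(j < q) (q - j < U (rot180 b) : nat) + 1.
  rewrite sum_ltn_below sum_ltn_above.
  by have := entry_bounds U b; have := entry_bounds U (rot180 b); lia.
rewrite (eq_bigr _ (fun U _ => E U)) big_split /= sum1_card mulSn addnC leq_add2l.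
rewrite big_split /= exchange_big [X in _ + X]exchange_big -big_split /=.
have -> : q * #|O| = \sum_(j < q) #|O| by rewrite sum_nat_const card_ord.
apply: leq_sum => j _.
rewrite shift -big_split /= -sum1_card; apply: leq_sum => U _.
case: (ltnP (q - j) (U (rot180 b))) => [lt|_]; last by rewrite addn0 leq_b1.
have le : (P ^+ (q - j))%g U b <= j.
  by have := promotion_edge edge lt; rewrite (subKn (ltnW (ltn_ord j))).
by rewrite (ltnNge j) le.
Qed.

Lemma sum_frame_le (O : {set inc_tableau m n q}) (b : box m n) : stable O ->
  b \in frame m n -> \sum_(U in O) (U b + U (rot180 b)) <= q.+1 * #|O|.
Proof.
move=> stO; rewrite inE => fb.
have [/(sum_edge_le stO)//|nb] := boolP ((b.1 == 0 :> nat) || (b.2 == 0 :> nat)).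
have e : ((rot180 b).1 == 0 :> nat) || ((rot180 b).2 == 0 :> nat).
  by have := ltn_ord b.1; have := ltn_ord b.2; move: fb nb => /=; lia.
under eq_bigr do rewrite addnC -{2}[b]rot180K.
exact: sum_edge_le.
Qed.

(** Reindexing the first summand by [complement] turns [U b] into [q + 1 - U (rot180 b)], which
    cancels the second. *)
Lemma sum_all_frame (b : box m n) :
  \sum_(U : inc_tableau m n q) (U b + U (rot180 b)) =
    q.+1 * #|{: inc_tableau m n q}|.
Proof.
rewrite big_split /= (reindex_inj (inv_inj complementK)) /= -big_split /=.
rewrite mulnC -sum_nat_const; apply: eq_bigr => U _.
by rewrite complement_entriesE; have := entry_bounds U (rot180 b); lia.
Qed.

(* Both [O] and its complement satisfy the upper bound, and for their union
   it is an equality. *)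
Lemma sum_frame (O : {set inc_tableau m n q}) (b : box m n) : stable O ->
  b \in frame m n -> \sum_(U in O) (U b + U (rot180 b)) = q.+1 * #|O|.
Proof.
move=> stO fb; apply/eqP; rewrite eqn_leq sum_frame_le //=.
have stC : stable (~: O) by move=> U; rewrite !inE stO.
have total := sum_all_frame b; rewrite (bigID (mem O)) /= in total.
rewrite -(leq_add2r (q.+1 * #|~: O|)) -mulnDr cardsC -total leq_add2l.
by have := sum_frame_le stC fb; under eq_bigl do rewrite inE.
Qed.

(** As [S] is invariant under rotation, twice its weight is the sum of [U b + U (rot180 b)] over
    [S], and [sum_frame] applies box by box. *)
Lemma sum_wt_frame (O : {set inc_tableau m n q}) (S : {set box m n}) : stable O ->
  S \subset frame m n -> [set rot180 b | b in S] = S ->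
  (\sum_(U in O) \sum_(b in S) U b).*2 = (q.+1 * #|S|) * #|O|.
Proof.
move=> stO /subsetP fS rS.
have rotS b : (rot180 b \in S) = (b \in S).
  by rewrite -{1}rS (mem_imset _ _ (inv_inj rot180K)).
have dbl U : (\sum_(b in S) U b).*2 = \sum_(b in S) (U b + U (rot180 b)).
  rewrite big_split -addnn; congr (_ + _).
  by rewrite (reindex_inj (inv_inj rot180K)) (eq_bigl _ _ rotS).
rewrite -muln2 big_distrl /=; under eq_bigr do rewrite muln2 dbl.
rewrite exchange_big (eq_bigr (fun=> q.+1 * #|O|)) => [|b /fS]; last first.
  exact: sum_frame.
by rewrite sum_nat_const mulnCA mulnA.
Qed.
End OrbitSums.

(** * Homomesy over the rationals *)

Import GRing.Theory Num.Theory.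

Theorem theorem1p6 (m n q : nat) (hm : 0 < m) (hn : 0 < n) (hq : 0 < q)
    (S : {set box m n}) (S_frame : S \subset frame m n)
    (S_rot : [set rot180 b | b in S] = S) :
  homomesic (promotion m n q) (wt S) (((q + 1) * #|S|)%N%:R / 2)%R.
Proof.
move=> O /imsetP[T _ eO].
have stO : stable O.
  move=> U; have := porbit_perm (promotion m n q) 1 U; rewrite expg1 => e.
  by rewrite eO -!eq_porbit_mem e.
have O0 : #|O| != 0 by rewrite eO card_porbit_neq0.
have -> : (\sum_(U in O) wt S U = (\sum_(U in O) \sum_(b in S) U b)%:R)%R.
  by rewrite natr_sum; apply: eq_bigr => U _; rewrite natr_sum.
apply/eqP; rewrite eqr_div ?pnatr_eq0 // -!natrM eqr_nat muln2 addn1.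
by rewrite (sum_wt_frame hq stO).
Qed.
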